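(* Let $\mathcal{P}$ be the set of rational polyhedra $P\subseteq\mathbb{R}^n$ (for some $n$) such that for any $k\in\mathbb{Z}_{\geq 0}$, any $r\in\{0,\ldots,k\}$ and any $w\in\mathbb{Z}^n$, the intersection $rP\cap(w-(k-r)P)$ is box-integer. Let $m\le n$ and let $\pi:\mathbb{R}^n\to\mathbb{R}^m$ be the projection onto the first $m$ coordinates. If $P\subseteq\mathbb{R}^n$ and $P\in\mathcal{P}$, then $\pi(P)$ has the Integer Carathéodory Property.
   Context: For a real number $t\ge 0$ and $P\subseteq\mathbb{R}^n$, $tP=\{tx: x\in P\}$, and $w-tP=\{w-tx: x\in P\}$. Inequalities between vectors are componentwise. Let $\bar{\mathbb{Z}}=\mathbb{Z}\cup\{-\infty,+\infty\}$. A polyhedron is called an integer polyhedron if each of its (nonempty) faces contains an integer point (in particular the empty polyhedron is an integer polyhedron). A polyhedron $Q\subseteq\mathbb{R}^n$ is box-integer if for every pair of vectors $c\le d$ in $\bar{\mathbb{Z}}^n$, the set $\{x\in Q: c\le x\le d\}$ is an integer polyhedron. A polyhedron $Q\subseteq\mathbb{R}^m$ has the Integer Carathéodory Property (ICP) if for every positive integer $k$ and every integer vector $w\in kQ$ there exist affinely independent $x_1,\ldots,x_t\in Q\cap\mathbb{Z}^m$ and $n_1,\ldots,n_t\in\mathbb{Z}_{\ge 0}$ such that $n_1+\cdots+n_t=k$ and $w=\sum_{i} n_i x_i$. *)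

(* Defs.v *)
(* MathComp world: R is an arbitrary realType, R^n is 'cV[R]_n. *)
From mathcomp Require Import all_boot all_order all_algebra.
From mathcomp Require Import boolp classical_sets reals constructive_ereal.

Set Implicit Arguments.
Unset Strict Implicit.
Unset Printing Implicit Defensive.

Import Order.TTheory GRing.Theory Num.Theory.

Local Open Scope classical_set_scope.
Local Open Scope ring_scope.

Definition lev (R : realType) (n : nat) (x y : 'cV[R]_n) : Prop :=
  forall i, x i 0 <= y i 0.

Definition integral (R : realType) (n : nat) (x : 'cV[R]_n) : Prop :=
  x \is a mxOver Num.int.

Definition polyhedron (R : realType) (n : nat) (P : set 'cV[R]_n) : Prop :=
  exists (p : nat) (A : 'M[R]_(p, n)) (b : 'cV[R]_p),
    P = [set x | lev (A *m x) b].

Definition rational_polyhedron (R : realType) (n : nat) (P : set 'cV[R]_n) :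
    Prop :=
  exists (p : nat) (A : 'M[rat]_(p, n)) (b : 'cV[rat]_p),
    P = [set x | lev (map_mx ratr A *m x) (map_mx ratr b)].

(* (a, d) = (0, 0) gives Q itself, so the faces are Q, its intersections with
   supporting hyperplanes, and the empty set. *)
Definition face (R : realType) (n : nat) (Q F : set 'cV[R]_n) : Prop :=
  exists (a : 'rV[R]_n) (d : R),
    (forall x, Q x -> (a *m x) 0 0 <= d) /\
    F = [set x | Q x /\ (a *m x) 0 0 = d].

Definition integer_polyhedron (R : realType) (n : nat) (Q : set 'cV[R]_n) :
    Prop :=
  polyhedron Q /\
  forall F, face Q F -> F !=set0 -> exists2 x, F x & integral x.

(* [\bar int] is Z extended with -oo and +oo; [er_map intr] embeds it into the
   extended reals. *)
Definition box (R : realType) (n : nat) (c d : 'cV[\bar int]_n) :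
    set 'cV[R]_n :=
  [set x : 'cV[R]_n | forall i, (er_map intr (c i 0%R) <= (x i 0%R)%:E
                      <= er_map intr (d i 0%R))%E].

Definition box_integer (R : realType) (n : nat) (Q : set 'cV[R]_n) : Prop :=
  polyhedron Q /\
  forall c d : 'cV[\bar int]_n, (forall i, (c i 0%R <= d i 0%R)%E) ->
    integer_polyhedron (Q `&` box c d).

Definition dilate (R : realType) (n : nat) (t : R) (P : set 'cV[R]_n) :
    set 'cV[R]_n :=
  [set t *: x | x in P].

Definition reflect_dilate (R : realType) (n : nat) (w : 'cV[R]_n) (t : R)
    (P : set 'cV[R]_n) : set 'cV[R]_n :=
  [set w - t *: x | x in P].

(* The family is indexed, so affine independence forces the points to be
   pairwise distinct. *)
Definition affinely_independent (R : realType) (n t : nat)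
    (x : 'I_t -> 'cV[R]_n) : Prop :=
  forall l : 'I_t -> R,
    \sum_i l i = 0 -> \sum_i l i *: x i = 0 -> forall i, l i = 0.

Definition ICP (R : realType) (m : nat) (Q : set 'cV[R]_m) : Prop :=
  polyhedron Q /\
  forall (k : nat) (w : 'cV[R]_m),
    (0 < k)%N -> integral w -> dilate k%:R Q w ->
    exists (t : nat) (x : 'I_t -> 'cV[R]_m) (a : 'I_t -> nat),
      [/\ affinely_independent x,
          forall i, Q (x i) /\ integral (x i),
          (\sum_i a i = k)%N
        & w = \sum_i (a i)%:R *: x i].

Definition classP (R : realType) (n : nat) (P : set 'cV[R]_n) : Prop :=
  rational_polyhedron P /\
  forall (k r : nat) (w : 'cV[R]_n), (r <= k)%N -> integral w ->
    box_integer (dilate r%:R P `&` reflect_dilate w (k - r)%:R P).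

Definition proj (R : realType) (n m : nat) (hmn : (m <= n)%N)
    (x : 'cV[R]_n) : 'cV[R]_m :=
  rowsub (widen_ord hmn) x.

(* Main.v *)
(* Let [w] be an integral point of [k pi(P)]. Cutting [kP] with the fibre
   [pi = w] and with [k] times a unit box [B] leaves a bounded rational
   polyhedron; its lexicographically largest point [y] is integral, since
   rational points of [kP] lie in some [kP `&` (w' - k (D - 1) P)] with [w']
   integral. As [y] is extreme, [pi] is injective on the affine hull of the
   points of any positive decomposition of [y] in [P `&` B], so it is enough to
   decompose [y] into affinely independent points of [P `&` B].

   This goes by induction on the number of nondegenerate sides of [B]. If
   [c_i < c_i + 1] is such a side and [r = y_i - k c_i] lies strictly between
   [0] and [k], then [y = u + v] with [u] in [r (P `&` B `&` {x_i = c_i + 1})]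
   and [v] in [(k - r) (P `&` B `&` {x_i = c_i})], because [y] is a sum of [k]
   integral points of [P `&` B]. The possible [u] form a box section of
   [rP `&` (y - (k - r) P)]; take [u] integral and extreme there. The affine
   hulls of the decompositions of [u] and [v] then have independent directions,
   and the coordinate [i] separates them, so the union of the two decompositions
   is affinely independent. *)
From HB Require Import structures.
Require Import Defs.
From mathcomp Require Import all_boot all_order all_algebra.
From mathcomp Require Import boolp classical_sets reals constructive_ereal.
From mathcomp Require Import ring lra zify.

Set Implicit Arguments.
Unset Strict Implicit.
Unset Printing Implicit Defensive.
Import Order.TTheory GRing.Theory Num.Theory.

Local Open Scope classical_set_scope.
Local Open Scope ring_scope.

(** * Linear inequalities in one variable and Fourier-Motzkin elimination *)

Lemma seq_argmin (F : realFieldType) (T : eqType) (f : T -> F) (s : seq T) :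
  s != [::] -> exists2 x, x \in s & {in s, forall y, f x <= f y}.
Proof.
elim: s => // a [|b s] IH _.
  by exists a; rewrite ?mem_head // => y; rewrite inE => /eqP->.
have [x xs xmin] := IH isT.
have [le_ax|/ltW le_xa] := leP (f a) (f x).
  exists a; first exact: mem_head.
  by move=> y; rewrite inE => /predU1P[->//|/xmin]; exact: le_trans.
exists x; first by rewrite inE xs orbT.
by move=> y; rewrite inE => /predU1P[->|/xmin].
Qed.

(** A positive coefficient gives an upper bound on [t], a negative one a lower bound. The least
    upper bound is a solution, since the second hypothesis puts every lower bound below every upper
    bound. Its tightness later certifies that a maximum is attained. *)
Lemma one_variable_system (F : realFieldType) (l : seq (F * F)) :
  {in l, forall c, c.1 = 0 -> 0 <= c.2} ->
  {in l &, forall p q, 0 < p.1 -> q.1 < 0 -> 0 <= - q.1 * p.2 + p.1 * q.2} ->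
  exists t, {in l, forall c, c.1 * t <= c.2} /\
    (has (fun c => 0 < c.1) l ->
     exists2 c, c \in l & 0 < c.1 /\ c.2 = c.1 * t).
Proof.
move=> l0 lpn.
have [lpos|lNpos] := boolP (has (fun c => 0 < c.1) l).
  have [|p] := @seq_argmin F _ (fun c => c.2 / c.1)
                 [seq c <- l | 0 < c.1]; first by rewrite -has_filter.
  rewrite mem_filter => /andP[p_gt0 pl] pmin.
  exists (p.2 / p.1); split=> [c cl|_]; last first.
    by exists p => //; rewrite mulrC divfK ?gt_eqF.
  have [c_lt0|c_gt0|c_eq0] := ltgtP c.1 0; last first.
  - by rewrite c_eq0 mul0r l0.
  - have := pmin c; rewrite mem_filter c_gt0 => /(_ cl).
    by rewrite ler_pdivlMr // mulrC.
  - have := lpn p c pl cl p_gt0 c_lt0.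
    by rewrite mulrA ler_pdivrMr // (mulrC c.2); lra.
(* Without upper bounds the largest lower bound is a solution, or [0] if there is none either; the
   tightness claim is then vacuous. *)
have cle0 c : c \in l -> c.1 <= 0.
  by move=> cl; rewrite leNgt; apply: contra lNpos => ?; apply/hasP; exists c.
have [lneg|lNneg] := boolP (has (fun c => c.1 < 0) l).
  have [|p] := @seq_argmin F _ (fun c => - (c.2 / c.1))
                 [seq c <- l | c.1 < 0]; first by rewrite -has_filter.
  rewrite mem_filter => /andP[p_lt0 pl] pmax.
  exists (p.2 / p.1); split=> // c cl.
  have := cle0 c cl; rewrite le_eqVlt => /predU1P[c0|c_lt0].
    by rewrite c0 mul0r l0.
  have := pmax c; rewrite mem_filter c_lt0 => /(_ cl).
  by rewrite lerN2 ler_ndivrMr // mulrC.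
exists 0; split=> // c cl; rewrite mulr0 l0 //; apply/eqP.
rewrite eq_le cle0 // leNgt; apply: contra lNneg => ?; apply/hasP.
by exists c.
Qed.

(* A pair (a, b) stands for the constraint [a x <= b]. *)
Definition constr (F : realFieldType) (n : nat) : Type := 'rV[F]_n * F.
HB.instance Definition _ (F : realFieldType) n :=
  Choice.copy (constr F n) ('rV[F]_n * F)%type.

Definition sat (F : realFieldType) (n : nat) (s : seq (constr F n))
    (x : 'cV[F]_n) : bool :=
  all (fun c => (c.1 *m x) 0 0 <= c.2) s.

Definition map_system (F K : realFieldType) (n : nat) (f : F -> K)
    (s : seq (constr F n)) : seq (constr K n) :=
  [seq (map_mx f c.1, f c.2) | c <- s].

(** One Fourier-Motzkin step. The dimension stays [n]: coordinate [j] is not dropped, but its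
    coefficient is zero in every resulting constraint. *)
Definition eliminate (F : realFieldType) (n : nat) (j : 'I_n)
    (s : seq (constr F n)) : seq (constr F n) :=
  [seq c : constr F n <- s | c.1 0 j == 0] ++
  [seq (- q.1 0 j *: p.1 + p.1 0 j *: q.1, - q.1 0 j * p.2 + p.1 0 j * q.2)
     | p : constr F n <- [seq c : constr F n <- s | 0 < c.1 0 j],
       q : constr F n <- [seq c : constr F n <- s | c.1 0 j < 0]].

Lemma mulmxD_delta (F : realFieldType) (n : nat) (a : 'rV[F]_n) (x : 'cV[F]_n)
    (t : F) (j : 'I_n) :
  (a *m (x + t *: delta_mx j (0 : 'I_1))) 0 0 = (a *m x) 0 0 + a 0 j * t.
Proof. by rewrite mulmxDr [LHS]mxE -scalemxAr -colE !mxE mulrC. Qed.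

Lemma mulmx_comb (F : realFieldType) (n : nat) (a b : 'rV[F]_n)
    (x : 'cV[F]_n) (t u : F) :
  ((t *: a + u *: b) *m x) 0 0 = t * (a *m x) 0 0 + u * (b *m x) 0 0.
Proof.
by rewrite mulmxDl -!scalemxAl [LHS]mxE; congr (_ + _); rewrite [LHS]mxE.
Qed.

(** The new constraints are nonnegative combinations of old ones, and their vanishing coefficient at
    [j] makes the shift by [t] harmless. *)
Lemma sat_eliminate (F : realFieldType) (n : nat) (j : 'I_n)
    (s : seq (constr F n)) (x : 'cV[F]_n) (t : F) :
  sat s x -> sat (eliminate j s) (x + t *: delta_mx j (0 : 'I_1)).
Proof.
move=> /allP sx; rewrite /sat all_cat; apply/andP; split; apply/allP => c.
  rewrite mem_filter => /andP[/eqP c0 /sx cx].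
  by rewrite mulmxD_delta c0 mul0r addr0.
case/allpairsP => -[p q] /= []; rewrite !mem_filter.
move=> /andP[p0 /sx px] /andP[q0 /sx qx] -> /=.
rewrite mulmxD_delta mulmx_comb.
have -> : (- q.1 0 j *: p.1 + p.1 0 j *: q.1) 0 j = 0 by rewrite !mxE; ring.
rewrite mul0r addr0; apply: lerD; apply: ler_wpM2l => //; last exact: ltW.
by rewrite oppr_ge0 ltW.
Qed.

(** With [x] fixed, the constraints of [s] form a one-variable system in [t], and the eliminated
    constraints are exactly its consistency conditions. *)
Lemma eliminate_sat (F : realFieldType) (n : nat) (j : 'I_n)
    (s : seq (constr F n)) (x : 'cV[F]_n) :
  sat (eliminate j s) x -> exists t, sat s (x + t *: delta_mx j (0 : 'I_1)).
Proof.
rewrite /sat all_cat => /andP[/allP s0 /allP spn].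
pose l := [seq (c.1 0 j, c.2 - (c.1 *m x) 0 0) | c : constr F n <- s].
have [||t [lt _]] := @one_variable_system F l.
- move=> _ /mapP[c cs ->] /= c0; rewrite subr_ge0 s0 //.
  by rewrite mem_filter c0 eqxx.
- move=> _ _ /mapP[p ps ->] /mapP[q qs ->] /= p0 q0.
  have /= := spn (- q.1 0 j *: p.1 + p.1 0 j *: q.1,
    - q.1 0 j * p.2 + p.1 0 j * q.2).
  rewrite mulmx_comb !mulrBr addrACA -opprD subr_ge0; apply.
  by apply/allpairsP; exists (p, q); rewrite !mem_filter p0 q0 ps qs.
exists t; apply/allP => c cs; rewrite mulmxD_delta.
have /= := lt (c.1 0 j, c.2 - (c.1 *m x) 0 0); rewrite lerBrDl; apply.
exact: map_f.
Qed.

(** Elimination uses only ring operations and sign tests, both preserved by [ratr]. This lets a real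
    problem be solved over the rationals. *)
Lemma map_eliminate (R : realFieldType) (n : nat) (j : 'I_n)
    (s : seq (constr rat n)) :
  map_system (ratr : rat -> R) (eliminate j s) =
  eliminate j (map_system ratr s).
Proof.
rewrite /map_system /eliminate map_cat map_allpairs /= !filter_map.
congr (_ ++ _).
  by congr map; apply: eq_filter => c /=; rewrite mxE fmorph_eq0.
rewrite allpairs_mapl allpairs_mapr.
have Epos : [seq c : constr rat n <- s | 0 < (map_mx ratr c.1 : 'rV[R]_n) 0 j] =
            [seq c : constr rat n <- s | 0 < c.1 0 j].
  by apply: eq_filter => c; rewrite mxE ltr0q.
have Eneg : [seq c : constr rat n <- s | (map_mx ratr c.1 : 'rV[R]_n) 0 j < 0] =
            [seq c : constr rat n <- s | c.1 0 j < 0].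
  by apply: eq_filter => c; rewrite mxE ltrq0.
rewrite -Epos -Eneg; apply: eq_allpairs => p q /=.
by rewrite !mxE map_mxD !map_mxZ !(rmorphD, rmorphM, rmorphN).
Qed.

Lemma coord_delta (F : realFieldType) (n : nat) (x : 'cV[F]_n) (t : F)
    (i j : 'I_n) :
  (x + t *: delta_mx j (0 : 'I_1)) i 0 = x i 0 + t * (i == j)%:R.
Proof. by rewrite !mxE eqxx andbT. Qed.

Definition eliminate_all (F : realFieldType) (n : nat) (js : seq 'I_n)
    (s : seq (constr F n)) : seq (constr F n) :=
  foldr (@eliminate F n) s js.

Lemma sat_eliminate_all (F : realFieldType) (n : nat) (js : seq 'I_n)
    (s : seq (constr F n)) (x y : 'cV[F]_n) :
  sat s x -> (forall i, i \notin js -> y i 0 = x i 0) ->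
  sat (eliminate_all js s) y.
Proof.
move=> sx; elim: js y => [|j js IH] y yx.
  by suff -> : y = x by []; apply/colP => i; exact: yx.
(* First give coordinate [j] its value in [x], so that the induction hypothesis applies, then move
   it back, which the eliminated system does not see. *)
have -> : y = (y + (x j 0 - y j 0) *: delta_mx j (0 : 'I_1)) +
              (y j 0 - x j 0) *: delta_mx j (0 : 'I_1).
  by apply/colP => k; rewrite !mxE; ring.
apply: sat_eliminate; apply: IH => i ijs; rewrite coord_delta.
have [->|ij] := eqVneq i j; first by rewrite mulr1 addrC subrK.
by rewrite mulr0 addr0 yx // inE negb_or ij.
Qed.

Lemma eliminate_all_sat (F : realFieldType) (n : nat) (js : seq 'I_n)
    (s : seq (constr F n)) (y : 'cV[F]_n) :
  sat (eliminate_all js s) y ->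
  exists2 x, sat s x & forall i, i \notin js -> x i 0 = y i 0.
Proof.
elim: js y => [|j js IH] y; first by exists y.
move=> /eliminate_sat[t /IH[x sx xy]]; exists x => // i.
rewrite inE negb_or => /andP[/negbTE ij /xy ->].
by rewrite coord_delta ij mulr0 addr0.
Qed.

Lemma map_eliminate_all (R : realFieldType) (n : nat) (js : seq 'I_n)
    (s : seq (constr rat n)) :
  map_system (ratr : rat -> R) (eliminate_all js s) =
  eliminate_all js (map_system ratr s).
Proof. by elim: js => //= j js IH; rewrite map_eliminate IH. Qed.

Lemma sat_map (R : realFieldType) (n : nat) (s : seq (constr rat n))
    (x : 'cV[rat]_n) :
  sat (map_system (ratr : rat -> R) s) (map_mx ratr x) = sat s x.
Proof.
rewrite /sat all_map; apply: eq_all => c /=.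
by rewrite -map_mxM mxE ler_rat.
Qed.

(** * Rational systems: projections and rational maximizers *)

(** Lists of constraints replace matrices because they can be concatenated, filtered and eliminated
    directly. *)
Definition rational_system (R : realType) (n : nat) (S : set 'cV[R]_n) : Prop :=
  exists s : seq (constr rat n), S = [set x | sat (map_system ratr s) x].

Lemma rational_polyhedron_system (R : realType) (n : nat) (P : set 'cV[R]_n) :
  rational_polyhedron P -> rational_system P.
Proof.
move=> [p [A [b ->]]]; exists [seq (row i A, b i 0) | i <- enum 'I_p].
apply/funext => x; apply/propext; rewrite /= /sat !all_map; split.
  move=> Ax; apply/allP => i _ /=.
  by have := Ax i; rewrite map_row -row_mul !mxE.
move=> /allP Ax i; have := Ax i; rewrite -enumT mem_enum /= => /(_ isT).
by rewrite map_row -row_mul !mxE.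
Qed.

Lemma projE (R : realType) (n m : nat) (hmn : (m <= n)%N) (x : 'cV[R]_n) i :
  proj hmn x i 0 = x (widen_ord hmn i) 0.
Proof. by rewrite mxE. Qed.

(** Eliminating the coordinates from [m] on describes the projection by constraints in which these
    coordinates may be set to zero, so the first [m] columns give the matrix. *)
Lemma polyhedron_proj (R : realType) (n m : nat) (hmn : (m <= n)%N)
    (P : set 'cV[R]_n) :
  rational_system P -> polyhedron (proj hmn @` P).
Proof.
move=> [s ->]; set sR := map_system _ s.
pose js := [seq j : 'I_n <- enum 'I_n | (m <= j)%N].
have inP i : (i \notin js) = (i < m)%N.
  by rewrite mem_filter mem_enum andbT ltnNge.
pose q := eliminate_all js sR.
pose pad (z : 'cV[R]_m) : 'cV[R]_n :=
  \col_i (if insub (i : nat) is Some j then z j 0 else 0).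
have padE (z : 'cV[R]_m) j : pad z (widen_ord hmn j) 0 = z j 0.
  rewrite mxE; case: insubP => [k _ /val_inj -> //|].
  by rewrite /= ltn_ord.
have pad0 (z : 'cV[R]_m) (i : 'I_n) : (m <= i)%N -> pad z i 0 = 0.
  by move=> mi; rewrite mxE insubF // ltnNge mi.
have mul_pad (a : 'rV[R]_n) z :
    (a *m pad z) 0 0 = \sum_j a 0 (widen_ord hmn j) * z j 0.
  rewrite mxE (bigID (fun i : 'I_n => (i < m)%N)) /= [X in _ + X]big1.
    rewrite addr0 (big_ord_narrow hmn); apply: eq_bigr => j _.
    by rewrite padE.
  by move=> i; rewrite -leqNgt => /pad0 ->; rewrite mulr0.
exists (size q), (\matrix_(i, j) (nth (0, 0) q i).1 0 (widen_ord hmn j)).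
exists (\col_i (nth (0, 0) q i).2).
have -> : proj hmn @` [set x | sat sR x] = [set z | sat q (pad z)].
  apply/seteqP; split=> [_ [x sx <-]|z /eliminate_all_sat[x sx xz]] /=.
    apply: (sat_eliminate_all sx) => i; rewrite inP => im.
    have -> : i = widen_ord hmn (Ordinal im) by exact: val_inj.
    by rewrite padE projE.
  exists x => //; apply/colP => j.
  by rewrite projE xz ?padE // inP /=.
apply/funext => z; apply/propext; split=> /=.
  move=> /allP qz i; have /= := qz _ (mem_nth (0, 0) (ltn_ord i)).
  rewrite mul_pad !mxE; apply: le_trans; rewrite le_eqVlt; apply/orP; left.
  by apply/eqP; apply: eq_bigr => j _; rewrite mxE.
move=> qz; apply/allP => c /(nthP (0, 0))[i iq <-].
have := qz (Ordinal iq); rewrite mul_pad !mxE; apply: le_trans.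
rewrite le_eqVlt; apply/orP; left.
by apply/eqP; apply: eq_bigr => j _; rewrite mxE.
Qed.

(** Eliminating all coordinates but [i] leaves a rational system in one variable. Its tight solution
    is the maximum, and it lifts to a rational point because the elimination can be undone over the
    rationals. *)
Lemma rational_max (R : realType) (n : nat) (S : set 'cV[R]_n) (i : 'I_n)
    (x0 : 'cV[R]_n) (M : R) :
  rational_system S -> S x0 -> (forall x, S x -> x i 0 <= M) ->
  exists2 p : 'cV[rat]_n, S (map_mx ratr p) &
    forall x, S x -> x i 0 <= ratr (p i 0).
Proof.
move=> [s ->] /= sx0 sM.
pose js := [seq j <- enum 'I_n | j != i].
have inP j : (j \notin js) = (j == i).
  by rewrite mem_filter mem_enum andbT negbK.
pose q := eliminate_all js s.
have qE : map_system ratr q = eliminate_all js (map_system (ratr : rat -> R) s).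
  exact: map_eliminate_all.
have qx (x : 'cV[R]_n) : sat (map_system ratr s) x ->
    {in q, forall c : constr rat n, ratr (c.1 0 i) * x i 0 <= ratr c.2}.
  move=> sx c cq.
  have : sat (map_system ratr q) (0 + x i 0 *: delta_mx i (0 : 'I_1)).
    rewrite qE; apply: (sat_eliminate_all sx) => j.
    by rewrite inP => /eqP ->; rewrite coord_delta eqxx mulr1 mxE add0r.
  move=> /allP /(_ (map_mx ratr c.1, ratr c.2)) /=.
  rewrite mulmxD_delta mulmx0 !mxE add0r; apply.
  exact: (map_f (fun c => (map_mx ratr c.1, ratr c.2)) cq).
pose l := [seq (c.1 0 i, c.2) | c : constr rat n <- q].
(* The real point [x0] proves the rational one-variable system consistent, as signs transfer along
   [ratr]. *)
have [||t [lt tight]] := @one_variable_system _ l.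
- move=> _ /mapP[c /(qx x0 sx0) + ->] /= c0.
  by rewrite c0 rmorph0 mul0r ler0q.
- move=> _ _ /mapP[c /(qx x0 sx0) cx ->] /mapP[d /(qx x0 sx0) dx ->] /= c0 d0.
  rewrite -(ler0q R) rmorphD !rmorphM rmorphN.
  have c0' : 0 < ratr (c.1 0 i) :> R by rewrite ltr0q.
  have d0' : ratr (d.1 0 i) < 0 :> R by rewrite ltrq0.
  by nra.
have qt : sat q (t *: delta_mx i (0 : 'I_1)).
  apply/allP => c cq; rewrite -[X in _ *m X]add0r mulmxD_delta mulmx0 mxE add0r.
  by apply: (lt (c.1 0 i, c.2)); apply: map_f.
have [p sp pt] := eliminate_all_sat qt.
have pi : p i 0 = t.
  by rewrite pt ?inP // -[_ *: _]add0r coord_delta eqxx mulr1 mxE add0r.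
exists p; first by rewrite sat_map.
move=> x sx; rewrite pi.
have [/tight[_ /mapP[c cq ->] /= [c0 ct]]|lNpos] :=
  boolP (has (fun c => 0 < c.1) l).
  have := qx x sx c cq; rewrite ct rmorphM ler_pM2l //.
  by rewrite ltr0q.
(* No constraint bounds coordinate [i] from above, so it can be raised: staying above [x i 0]
   preserves the lower bounds, and exceeding [M] gives a contradiction. *)
have : sat (map_system (ratr : rat -> R) q)
    ((Num.max M (x i 0) + 1) *: delta_mx i (0 : 'I_1)).
  apply/allP => _ /mapP[c cq ->] /=.
  rewrite -[X in _ *m X]add0r mulmxD_delta mulmx0 !mxE add0r.
  apply: le_trans (qx x sx c cq).
  have c0 : ratr (c.1 0 i) <= 0 :> R.
    rewrite lerq0 leNgt; apply: contra lNpos => c0.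
    by apply/hasP; exists (c.1 0 i, c.2) => //; apply: map_f.
  by apply: ler_wnM2l => //; rewrite ler_wpDr // le_max lexx orbT.
rewrite qE => /eliminate_all_sat[y /sM yM /(_ i)].
rewrite inP eqxx => /(_ isT) yi; move: yM.
rewrite yi -[_ *: _]add0r coord_delta eqxx mulr1 mxE add0r leNgt.
by rewrite ltr_pwDr // le_max lexx.
Qed.

(** * Integral vectors, integral boxes and closure properties of rational systems *)

Definition zvec (R : realType) (n : nat) (u : 'cV[int]_n) : 'cV[R]_n :=
  map_mx intr u.
Arguments zvec R {n} u.

Definition ibox (R : realType) (n : nat) (c d : 'cV[int]_n) : set 'cV[R]_n :=
  [set x : 'cV[R]_n | forall i, (c i 0)%:~R <= x i 0 <= (d i 0)%:~R].
Arguments ibox {R n} c d.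

Lemma integralP (R : realType) (n : nat) (x : 'cV[R]_n) :
  integral x -> exists u, x = zvec R u.
Proof.
move=> /mxOverP ix; exists (\col_i Num.floor (x i 0)); apply/colP => i.
by rewrite !mxE floorK.
Qed.

Lemma integral_zvec (R : realType) (n : nat) (u : 'cV[int]_n) :
  integral (zvec R u).
Proof. by apply/mxOverP => i j; rewrite mxE intr_int. Qed.

Lemma map_zvec (R : realType) (n : nat) (u : 'cV[int]_n) :
  map_mx ratr (map_mx intr u) = zvec R u.
Proof. by apply/colP => i; rewrite !mxE ratr_int. Qed.

Lemma ibox_box (R : realType) (n : nat) (c d : 'cV[int]_n) :
  ibox c d = box (\col_i (c i 0)%:E) (\col_i (d i 0)%:E) :> set 'cV[R]_n.
Proof.
by apply/funext => x; apply/propext; split=> H i; have := H i;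
  rewrite !mxE /= !lee_fin.
Qed.

Lemma dilateP (R : realType) (n : nat) (t : R) (P : set 'cV[R]_n) x :
  0 < t -> dilate t P x <-> P (t^-1 *: x).
Proof.
move=> t0; split=> [[z Pz <-]|Px]; first by rewrite scalerK ?gt_eqF.
by exists (t^-1 *: x) => //; rewrite scalerKV ?gt_eqF.
Qed.

Lemma reflect_dilateP (R : realType) (n : nat) (w : 'cV[R]_n) t P x :
  reflect_dilate w t P x <-> dilate t P (w - x).
Proof.
split=> [[z Pz <-]|[z Pz zE]]; first by exists z; rewrite // subKr.
by exists z; rewrite // zE subKr.
Qed.

Lemma rational_systemI (R : realType) (n : nat) (S T : set 'cV[R]_n) :
  rational_system S -> rational_system T -> rational_system (S `&` T).
Proof.
move=> [s ->] [t ->]; exists (s ++ t).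
apply/funext => x; apply/propext.
by rewrite /= /sat /map_system map_cat all_cat; split=> [[-> ->]|/andP[-> ->]].
Qed.

(** Preimages under rational affine maps cover both dilations, with [a] the inverse of the factor,
    and reflections, with [a = -1]. *)
Lemma rational_system_affine (R : realType) (n : nat) (S : set 'cV[R]_n)
    (a : rat) (b : 'cV[rat]_n) :
  rational_system S ->
  rational_system [set x | S (ratr a *: x + map_mx ratr b)].
Proof.
move=> [s ->]; exists [seq (a *: c.1, c.2 - (c.1 *m b) 0 0) | c <- s].
apply/funext => x; apply/propext; rewrite /= /sat !all_map.
suff -> : all (preim (fun c : constr rat n => (map_mx ratr c.1, ratr c.2))
   (fun c => (c.1 *m (ratr a *: x + map_mx ratr b)) 0 0 <= c.2)) s =
  all (preim (fun c : constr rat n => (a *: c.1, c.2 - (c.1 *m b) 0 0))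
     (preim (fun c : constr rat n => (map_mx ratr c.1, ratr c.2))
        (fun c => (c.1 *m x) 0 0 <= c.2))) s by [].
apply: eq_all => c /=.
rewrite rmorphB /= lerBrDr map_mxZ mulmxDr -map_mxM -scalemxAl -scalemxAr.
by rewrite [in LHS]mxE; congr (_ + _ <= _); rewrite mxE.
Qed.

Lemma row_delta (R : realType) (n : nat) (x : 'cV[R]_n) (i : 'I_n) :
  ((delta_mx 0 i : 'rV[R]_n) *m x) 0 0 = x i 0.
Proof. by rewrite -rowE mxE. Qed.

Lemma rational_system_ibox (R : realType) (n : nat) (c d : 'cV[int]_n) :
  rational_system (ibox c d : set 'cV[R]_n).
Proof.
exists ([seq (delta_mx 0 i, (d i 0)%:~R) | i <- enum 'I_n] ++
        [seq (- delta_mx 0 i, - (c i 0)%:~R) | i <- enum 'I_n]).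
have deltaE (x : 'cV[R]_n) i :
    (map_mx ratr (delta_mx 0 i : 'rV[rat]_n) *m x) 0 0 = x i 0.
  by rewrite map_delta_mx row_delta.
apply/funext => x; apply/propext.
rewrite /= /sat /map_system map_cat all_cat !all_map; split=> [H|].
  apply/andP; split; apply/allP => i _ /=; have /andP[cx xd] := H i.
    by rewrite deltaE ratr_int.
  by rewrite map_mxN mulNmx mxE deltaE rmorphN lerN2 /= ratr_int.
move=> /andP[/allP xd /allP xc] i; move: (xd i) (xc i).
rewrite -enumT mem_enum /= => /(_ isT) + /(_ isT).
rewrite deltaE map_mxN mulNmx mxE deltaE rmorphN lerN2 /= !ratr_int.
by move=> -> ->.
Qed.

Lemma rational_system_dilate (R : realType) (n : nat) (P : set 'cV[R]_n) k :
  (0 < k)%N -> rational_system P -> rational_system (dilate k%:R P).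
Proof.
move=> k0 /(rational_system_affine k%:R^-1 0); congr rational_system.
apply/funext => x; apply/propext; rewrite /= map_mx0 addr0 fmorphV /= ratr_nat.
by rewrite dilateP // ltr0n.
Qed.

Lemma rational_system_reflect (R : realType) (n : nat) (P : set 'cV[R]_n) k
    (y : 'cV[int]_n) :
  (0 < k)%N -> rational_system P ->
  rational_system (reflect_dilate (zvec R y) k%:R P).
Proof.
move=> k0 /(rational_system_dilate k0).
move=> /(rational_system_affine (-1) (map_mx intr y)); congr rational_system.
apply/funext => x; apply/propext; rewrite /= map_zvec rmorphN rmorph1 scaleN1r.
by rewrite addrC reflect_dilateP.
Qed.

(** The points of [Q] in the box that maximize coordinate [i] form a nonempty face. It contains an
    integral point, whose coordinate [i] is the maximum. *)
Lemma box_integer_point (R : realType) (n : nat) (Q : set 'cV[R]_n)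
    (c d : 'cV[int]_n) (i : 'I_n) (x0 : 'cV[R]_n) :
  box_integer Q -> Q x0 -> ibox c d x0 ->
  (forall x, Q x -> ibox c d x -> x i 0 <= x0 i 0) ->
  exists z : int, x0 i 0 = z%:~R.
Proof.
move=> [_ Qbox] Qx0 bx0 x0max.
have [j|_ /(_ [set x | (Q `&` ibox c d) x /\ x i 0 = x0 i 0])] :=
    Qbox (\col_i (c i 0)%:E) (\col_i (d i 0)%:E).
  rewrite !mxE lee_fin -(ler_int R).
  by have /andP[] := bx0 j; exact: le_trans.
case=> [||x [[_ _] <-] /integralP[u ->]].
- exists (delta_mx 0 i), (x0 i 0); split=> [x|].
    by rewrite -ibox_box -rowE mxE => -[? ?]; exact: x0max.
  apply/funext => x; apply/propext; rewrite -ibox_box /= -rowE.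
  by rewrite [(row _ _) _ _]mxE.
- by exists x0.
by exists (u i 0); rewrite mxE.
Qed.

(** * Integral extreme points of box sections *)

Definition upd (n : nat) (c : 'cV[int]_n) (i : 'I_n) (z : int) : 'cV[int]_n :=
  \col_j (if j == i then z else c j 0).

Lemma upd_id (n : nat) (c : 'cV[int]_n) (i : 'I_n) z : upd c i z i 0 = z.
Proof. by rewrite mxE eqxx. Qed.

Lemma upd_ne (n : nat) (c : 'cV[int]_n) (i j : 'I_n) z :
  j != i -> upd c i z j 0 = c j 0.
Proof. by rewrite mxE => /negbTE ->. Qed.

Definition extreme (R : realType) (n : nat) (S : set 'cV[R]_n) (x : 'cV[R]_n) :
    Prop :=
  S x /\ forall e, S (x + e) -> S (x - e) -> e = 0.

(* The extreme point is the lexicographically largest one for some order of the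
   coordinates: each maximum is attained at a rational point. *)
Lemma extreme_integral (R : realType) (n : nat) (S : set 'cV[R]_n) :
  rational_system S ->
  (forall c d i (p : 'cV[rat]_n),
     S (map_mx ratr p) -> ibox c d (map_mx ratr p : 'cV[R]_n) ->
     (forall x, S x -> ibox c d x -> x i 0 <= ratr (p i 0)) ->
     exists z : int, ratr (p i 0) = z%:~R :> R) ->
  forall c d, S `&` ibox c d !=set0 ->
  exists u, extreme (S `&` ibox c d) (zvec R u).
Proof.
move=> ratS maxS c d; have [N] := ubnP #|[pred i | c i 0 != d i 0]|.
elim: N c d => // N IH c d cdN [x0 [Sx0 bx0]].
have [/existsP[i cdi]|/existsPn cd] := boolP [exists i, c i 0 != d i 0].
  have [|||p [Sp bp] pmax] := @rational_max R n (S `&` ibox c d) i x0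
      (d i 0)%:~R.
  - exact/rational_systemI/rational_system_ibox.
  - by [].
  - by move=> x [_ /(_ i)/andP[]].
  have [z pz] : exists z : int, ratr (p i 0) = z%:~R :> R.
    by apply: (maxS c d) => // x Sx bx; apply: pmax.
  (* Freezing coordinate [i] at its integral maximum makes one more side degenerate, so the
     induction hypothesis applies. *)
  pose f a := upd a i z.
  have sub (x : 'cV[R]_n) : ibox (f c) (f d) x -> ibox c d x.
    move=> fx j; have := fx j; rewrite !mxE; case: eqP => [->|//].
    rewrite -pz; case/andP => zx xz.
    have /andP[cp pd] := bp i; rewrite mxE in cp pd.
    by rewrite (le_trans cp) // (le_trans xz).
  have [||u [[Su bu] uext]] := IH (f c) (f d).
  - move: cdN; rewrite ltnS; apply: leq_trans; apply: proper_card;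
    apply/properP; split.
      apply/fintype.subsetP => j; rewrite !inE !mxE.
      by case: (j =P i) => // _; rewrite eqxx.
    by exists i; rewrite !inE ?cdi // !mxE eqxx negbK.
  - exists (map_mx ratr p); split=> // j; rewrite [(map_mx _ _) _ _]mxE.
    rewrite ![(f _) _ _]mxE; case: eqP => [->|_]; first by rewrite pz lexx.
    by have := bp j; rewrite mxE.
  exists u; split=> [|e [Sue bue] [Sune bune]]; first by split=> //; exact: sub.
  have ui : u i 0 = z.
    have := bu i; rewrite !mxE eqxx => ?; apply/eqP.
    by rewrite -(eqr_int R) eq_le andbC.
  have ei : e i 0 = 0.
    have := pmax _ (conj Sue bue); have := pmax _ (conj Sune bune).
    by rewrite pz !mxE ui; lra.
  apply: uext; split=> // j.
    have := bue j; rewrite !mxE; case: (j =P i) => // -> _.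
    by rewrite ei ui addr0 lexx.
  have := bune j; rewrite !mxE; case: (j =P i) => // -> _.
  by rewrite ei ui subr0 lexx.
have ibE (x : 'cV[R]_n) : ibox c d x -> x = zvec R c.
  move=> bx; apply/colP => i; have := bx i; have /negbNE/eqP <- := cd i.
  by rewrite -eq_le mxE => /eqP ->.
exists c; split=> [|e [_ /ibE + ] _]; first by rewrite -(ibE _ bx0).
by move/eqP; rewrite -subr_eq0 addrAC subrr add0r => /eqP.
Qed.

Lemma common_denominator (R : realType) (n : nat) (p : 'cV[rat]_n) :
  exists D w, (0 < D)%N /\ D%:R *: map_mx ratr p = zvec R w.
Proof.
pose den i := absz (denq (p i 0)).
pose w := \col_i (numq (p i 0) * (\prod_(j | j != i) den j)%:Z).
exists (\prod_i den i)%N, w; split.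
  by rewrite prodn_gt0 // => i; rewrite absz_gt0 denq_neq0.
apply/colP => i; rewrite !mxE (bigD1 i) //= natrM mulrAC intrM.
congr (_ * _); rewrite -[in X in ratr X](divq_num_den (p i 0)) fmorph_div.
rewrite /= !ratr_int mulrC /den.
rewrite -[_%:R]/((Posz _)%:~R) absz_denq divfK // intr_eq0.
exact: denq_neq0.
Qed.

Lemma dilate_ibox (R : realType) (n k : nat) (P : set 'cV[R]_n)
    (c d : 'cV[int]_n) (x : 'cV[R]_n) :
  (0 < k)%N ->
  dilate k%:R (P `&` ibox c d) x <->
  dilate k%:R P x /\ ibox (c *+ k) (d *+ k) x.
Proof.
move=> k_gt0; have k0 : 0 < k%:R :> R by rewrite ltr0n.
rewrite !dilateP //.
suff bE : ibox c d (k%:R^-1 *: x) <-> ibox (c *+ k) (d *+ k) x.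
  by split=> -[? ?]; split=> //; exact/bE.
split=> bx i; have := bx i; rewrite !mulmxnE !mxE !pmulrn.
  by rewrite ler_pdivlMl // ler_pdivrMl // !rmorphMn /= !mulr_natl.
by rewrite ler_pdivlMl // ler_pdivrMl // !rmorphMn /= !mulr_natl.
Qed.

Lemma dilate_extreme (R : realType) (n k : nat) (P : set 'cV[R]_n)
    (c d : 'cV[int]_n) :
  classP P -> (0 < k)%N -> dilate k%:R P `&` ibox c d !=set0 ->
  exists u, extreme (dilate k%:R P `&` ibox c d) (zvec R u).
Proof.
move=> [ratP boxP] k_gt0; have k0 : 0 < k%:R :> R by rewrite ltr0n.
apply: extreme_integral.
  exact/rational_system_dilate/rational_polyhedron_system.
move=> {}c {}d i p Pp bp pmax.
(* [p] lies in [kP `&` (D p - k (D - 1) P)], where [D p] is integral. *)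
have [D [w [D_gt0 Dp]]] := common_denominator R p.
have kD : (k <= k * D)%N by rewrite leq_pmulr.
have := @box_integer_point _ _ _ c d i (map_mx ratr p)
  (boxP (k * D)%N k (zvec R w) kD (integral_zvec _ _)).
rewrite mxE; apply=> [|//|x [Px _]]; last exact: pmax.
split=> //; apply/reflect_dilateP; rewrite -Dp.
move: Pp => [x Px <-]; exists x => //.
by rewrite natrB // natrM scalerA -scalerBl mulrC.
Qed.

(** Box constraints on [x] and on [y - x] are both box constraints on [x], with integral bounds
    because [y] is integral. Thus [T] is a box section of [rP] intersected with [y - sP], which is
    box-integer by [classP] for the total [r + s]. *)
Lemma split_extreme (R : realType) (n r s : nat) (P : set 'cV[R]_n)
    (c1 d1 c2 d2 y : 'cV[int]_n) :
  let T := [set x | dilate r%:R (P `&` ibox c1 d1) x /\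
                    dilate s%:R (P `&` ibox c2 d2) (zvec R y - x)] in
  classP P -> (0 < r)%N -> (0 < s)%N -> T !=set0 ->
  exists u, extreme T (zvec R u).
Proof.
move=> T [ratP boxP] r_gt0 s_gt0.
pose S := dilate r%:R P `&` reflect_dilate (zvec R y) s%:R P.
pose c := \col_i Num.max (c1 i 0 *+ r) (y i 0 - d2 i 0 *+ s).
pose d := \col_i Num.min (d1 i 0 *+ r) (y i 0 - c2 i 0 *+ s).
have maxE (a b : int) (t : R) :
    ((Num.max a b)%:~R <= t) = (a%:~R <= t) && (b%:~R <= t).
  by case: (leP a b) => ab; apply/idP/andP => [bt|[]//]; split=> //;
    apply: le_trans bt; rewrite ler_int // ltW.
have minE (a b : int) (t : R) :
    (t <= (Num.min a b)%:~R) = (t <= a%:~R) && (t <= b%:~R).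
  by case: (leP a b) => ab; apply/idP/andP => [ta|[]//]; split=> //;
    apply: le_trans ta _; rewrite ler_int // ltW.
have TE : T = S `&` ibox c d.
  apply/funext => x; apply/propext; rewrite /T /S /= !dilate_ibox //.
  rewrite reflect_dilateP.
  have -> : ibox c d x = (ibox (c1 *+ r) (d1 *+ r) x /\
      ibox (c2 *+ s) (d2 *+ s) (zvec R y - x)).
    have bE i : ((c i 0)%:~R <= x i 0 <= (d i 0)%:~R) =
        (((c1 *+ r) i 0)%:~R <= x i 0 <= ((d1 *+ r) i 0)%:~R) &&
        (((c2 *+ s) i 0)%:~R <= (zvec R y - x) i 0 <= ((d2 *+ s) i 0)%:~R).
      rewrite !mulmxnE !mxE maxE minE !intrB andbACA; congr (_ && _).
      rewrite andbC; congr (_ && _); first by apply/idP/idP; lra.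
      by apply/idP/idP; lra.
    apply/propext; split=> [bx|[bx byx] i]; last first.
      by apply/idP; rewrite bE bx byx.
    by split=> i; have /idP := bx i; rewrite bE => /andP[].
  by tauto.
rewrite TE; apply: extreme_integral .
  apply: rational_systemI.
    exact/rational_system_dilate/rational_polyhedron_system.
  exact/rational_system_reflect/rational_polyhedron_system.
move=> c' d' i p Sp bp pmax.
have := @box_integer_point _ _ _ c' d' i (map_mx ratr p)
  (boxP (r + s)%N r (zvec R y) (leq_addr _ _) (integral_zvec _ _)).
by rewrite addKn mxE; apply.
Qed.

(** * Decomposition into integral points and splitting of a box *)

Lemma zvecB (R : realType) (n : nat) (u v : 'cV[int]_n) :
  zvec R (u - v) = zvec R u - zvec R v.
Proof. exact: map_mxB. Qed.

(** Convexity of [S], for nonnegative weights of total [t] instead of 1. *)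
Lemma dilate_wsum (R : realType) (n : nat) (S : set 'cV[R]_n) (I : Type)
    (r : seq I) (Q : pred I) (a : I -> R) (x : I -> 'cV[R]_n) (t : R) :
  rational_system S -> (forall i, Q i -> 0 <= a i /\ S (x i)) -> 0 < t ->
  \sum_(i <- r | Q i) a i = t -> dilate t S (\sum_(i <- r | Q i) a i *: x i).
Proof.
move=> [s ->] QS t0 at_; apply/dilateP => //=; apply/allP => c cs.
rewrite -scalemxAr [leLHS]mxE ler_pdivrMl // -at_ mulmx_sumr summxE mulr_suml.
apply: ler_sum => i /QS[a0 /allP /(_ c cs) cx].
by rewrite -scalemxAr [leLHS]mxE ler_wpM2l.
Qed.

Lemma rational_systemPI (R : realType) (n : nat) (P : set 'cV[R]_n)
    (c d : 'cV[int]_n) :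
  classP P -> rational_system (P `&` ibox c d).
Proof.
move=> [/rational_polyhedron_system ratP _].
exact/rational_systemI/rational_system_ibox.
Qed.

(** Integral points are split off one at a time: [split_extreme] with [r = 1] leaves an integral
    remainder in a smaller dilate. Extremality is not involved here. *)
Lemma integer_decomposition (R : realType) (n k : nat) (P : set 'cV[R]_n)
    (c d y : 'cV[int]_n) :
  classP P -> (0 < k)%N -> dilate k%:R (P `&` ibox c d) (zvec R y) ->
  exists z : seq 'cV[int]_n,
    [/\ size z = k, {in z, forall v, (P `&` ibox c d) (zvec R v)} &
        y = \sum_(v <- z) v].
Proof.
move=> PP; case: k => // k _; elim: k y => [|k IH] y.
  move=> [x PIx]; rewrite scale1r => xy; rewrite xy in PIx.
  exists [:: y]; split=> //; last by rewrite big_seq1.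
  by move=> v; rewrite inE => /eqP ->.
move=> [x Px xy].
have [//|//||u [[[u' Pu' uu'] /=]]] :=
    @split_extreme R n 1 k.+1 P c d c d y PP.
  (* If [y = (k + 2) x], then [x] and [(k + 1) x] are a real splitting, which makes the set
     nonempty. *)
  exists x; split; first by exists x; rewrite ?scale1r.
  by exists x => //; rewrite -xy -[k.+2%:R]natr1 scalerDl scale1r addrK.
rewrite -zvecB => /IH[z [zk Pz zE]] _; exists (u :: z); split.
- by rewrite /= zk.
- move=> v; rewrite inE => /predU1P[->|/Pz //].
  by rewrite -uu' scale1r.
- by rewrite big_cons -zE addrC subrK.
Qed.

(** Side [i] has length one, so each of the [k] integral summands of [y] lies on its lower or its
    upper end. Grouping the summands accordingly gives the two parts. *)
Lemma split_box (R : realType) (n k r : nat) (P : set 'cV[R]_n)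
    (c d y : 'cV[int]_n) (i : 'I_n) :
  classP P -> d i 0 = c i 0 + 1 -> y i 0 = c i 0 *+ k + r%:Z ->
  (0 < r)%N -> (r < k)%N ->
  dilate k%:R (P `&` ibox c d) (zvec R y) ->
  [set x | dilate r%:R (P `&` ibox (upd c i (d i 0)) d) x /\
           dilate (k - r)%:R (P `&` ibox c (upd d i (c i 0))) (zvec R y - x)]
    !=set0.
Proof.
move=> PP di yi r0 rk /integer_decomposition[//||z [zk Pz zE]].
  exact: leq_ltn_trans rk.
have zi v : v \in z -> v i 0 = c i 0 \/ v i 0 = d i 0.
  move=> /Pz[_ /(_ i)]; rewrite mxE !ler_int di.
  by move: (v i 0) (c i 0) => a b; lia.
pose Q (v : 'cV[int]_n) := v i 0 == d i 0.
(* In coordinate [i] every summand contributes [c i 0], and one more if it lies on the upper end, so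
   the excess [r] counts the latter. *)
have zr : count Q z = r.
  suff : y i 0 = c i 0 *+ k + (count Q z)%:Z.
    by rewrite yi => /addrI [].
  rewrite zE summxE -zk; elim: z zi {Pz zE zk} => [|v z IH] zi.
    by rewrite big_nil /= mulr0n.
  rewrite big_cons IH /= => [|w wz]; last by apply: zi; rewrite inE wz orbT.
  have := zi v (mem_head _ _); rewrite /Q mulrS di; case: eqP => /=; lia.
have zr' : count (predC Q) z = (k - r)%N.
  by rewrite -zr -zk -(count_predC Q z) addKn.
have cntE (A : pred 'cV[int]_n) :
    \sum_(v <- z | (v \in z) && A v) 1%R = (count A z)%:R :> R.
  by rewrite -big_seq_cond -sum1_count natr_sum.
have sumE (A : pred 'cV[int]_n) : \sum_(v <- z | A v) zvec R v =
    \sum_(v <- z | (v \in z) && A v) (1 : R) *: zvec R v.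
  by rewrite big_seq_cond; apply: eq_bigr => v _; rewrite scale1r.
exists (\sum_(v <- z | Q v) zvec R v); split.
  rewrite sumE; apply: dilate_wsum; rewrite ?ltr0n ?cntE ?zr //.
    exact: rational_systemPI.
  move=> v /andP[/Pz[Pv bv] /eqP vi]; split=> //; split=> // j.
  have := bv j; case: (eqVneq j i) => [->|ji]; last by rewrite upd_ne.
  by rewrite upd_id mxE vi lexx.
have -> : zvec R y - \sum_(v <- z | Q v) zvec R v =
    \sum_(v <- z | predC Q v) zvec R v.
  by rewrite zE /zvec map_mx_sum (bigID Q) /= addrAC subrr add0r.
rewrite sumE; apply: dilate_wsum; rewrite ?ltr0n ?cntE ?zr' ?subn_gt0 //.
  exact: rational_systemPI.
move=> v /andP[vz /= vQ]; have [Pv bv] := Pz v vz; split=> //; split=> // j.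
have := bv j; case: (eqVneq j i) => [->|ji]; last by rewrite upd_ne.
rewrite upd_id mxE; case: (zi v vz) => vi; first by rewrite vi lexx.
by move: vQ; rewrite /Q vi eqxx.
Qed.

(** * Affinely independent decompositions *)

(** The multiplicities are positive so that small changes of either sign keep the weights
    nonnegative. *)
Definition decomposition (R : realType) (n : nat) (S : set 'cV[R]_n) (k : nat)
    (y : 'cV[int]_n) : Prop :=
  exists (t : nat) (x : 'I_t -> 'cV[int]_n) (a : 'I_t -> nat),
    [/\ affinely_independent (fun i => zvec R (x i)),
        forall i, S (zvec R (x i)),
        forall i, (0 < a i)%N,
        (\sum_i a i)%N = k &
        zvec R y = \sum_i (a i)%:R *: zvec R (x i)].

Lemma decomposition_sub (R : realType) (n : nat) (S S' : set 'cV[R]_n) k y :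
  S `<=` S' -> decomposition S k y -> decomposition S' k y.
Proof.
by move=> sub [t [x [a [? ? ? ? ?]]]]; exists t, x, a; split=> // i; apply: sub.
Qed.

(** The weights [a i + l i] are nonnegative because [a i] is at least 1, and they still add up to
    [k]. *)
Lemma dilate_perturb (R : realType) (n t k : nat) (S : set 'cV[R]_n)
    (x : 'I_t -> 'cV[R]_n) (a : 'I_t -> nat) (l : 'I_t -> R) :
  rational_system S -> (forall i, S (x i)) -> (forall i, (0 < a i)%N) ->
  (\sum_i a i)%N = k -> (0 < k)%N -> \sum_i l i = 0 ->
  (forall i, `|l i| <= 1) ->
  dilate k%:R S (\sum_i (a i)%:R *: x i + \sum_i l i *: x i).
Proof.
move=> ratS Sx a0 ak k0 l0 l1; rewrite -big_split /=.
under eq_bigr => i _ do rewrite -scalerDl.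
apply: dilate_wsum; rewrite ?ltr0n //; last first.
  by rewrite big_split /= l0 addr0 -natr_sum ak.
move=> i _; split=> //; have := l1 i; rewrite ler_norml => /andP[li _].
have : 1 <= (a i)%:R :> R by rewrite ler1n.
by lra.
Qed.

Lemma exists_scale (R : realType) (t : nat) (l : 'I_t -> R) :
  exists2 e : R, 0 < e & forall i, `|e * l i| <= 1.
Proof.
have s0 : 0 < 1 + \sum_i `|l i| by rewrite ltr_pwDl // sumr_ge0.
exists (1 + \sum_i `|l i|)^-1; first by rewrite invr_gt0.
move=> i; rewrite normrM gtr0_norm ?invr_gt0 // ler_pdivrMl // mulr1.
rewrite (bigD1 i) //= addrCA lerDl addr_ge0 //; exact: sumr_ge0.
Qed.

(* Affine dependences among the two decompositions perturb [u] in both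
   directions, so they are trivial when [u] is extreme. *)
Lemma decomposition_join (R : realType) (n r s : nat) (S1 S2 : set 'cV[R]_n)
    (i : 'I_n) (p q : R) (u y : 'cV[int]_n) :
  rational_system S1 -> rational_system S2 -> p != q ->
  (forall x, S1 x -> x i 0 = p) -> (forall x, S2 x -> x i 0 = q) ->
  (0 < r)%N -> (0 < s)%N ->
  extreme [set x | dilate r%:R S1 x /\ dilate s%:R S2 (zvec R y - x)]
    (zvec R u) ->
  decomposition S1 r u -> decomposition S2 s (y - u) ->
  decomposition (S1 `|` S2) (r + s)%N y.
Proof.
move=> rat1 rat2 pq S1p S2q r0 s0 [_ uext].
move=> [t1 [x1 [a1 [ind1 Sx1 a10 ar uE]]]].
move=> [t2 [x2 [a2 [ind2 Sx2 a20 as_ vE]]]].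
exists (t1 + t2)%N.
exists (fun j => match split j with inl j => x1 j | inr j => x2 j end).
exists (fun j => match split j with inl j => a1 j | inr j => a2 j end).
have splitl (j : 'I_t1) : split (lshift t2 j) = inl j.
  exact: (unsplitK (inl j)).
have splitr (j : 'I_t2) : split (rshift t1 j) = inr j.
  exact: (unsplitK (inr j)).
split; last first.
- rewrite big_split_ord /=.
  under eq_bigr do rewrite splitl; under [X in _ + X]eq_bigr do rewrite splitr.
  by rewrite -uE -vE zvecB addrC subrK.
- rewrite big_split_ord /=.
  under eq_bigr do rewrite splitl.
  under [X in (_ + X)%N]eq_bigr do rewrite splitr.
  by rewrite ar as_.
- by move=> j; case: (split j).
- by move=> j; case: (split j) => j'; [left|right].
move=> L; rewrite !big_split_ord /=.
under [X in _ -> X + _ = _ -> _]eq_bigr do rewrite splitl.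
under [X in _ -> _ + X = _ -> _]eq_bigr do rewrite splitr.
set l1 := fun j => L (lshift t2 j); set l2 := fun j => L (rshift t1 j).
rewrite -/(\sum_j l1 j) -/(\sum_j l2 j) => L0 Lx.
(* Coordinate [i] is [p] on [S1] and [q] on [S2]. Together with [L0] and [p != q], this makes each
   of the two coefficient sums vanish. *)
have : (\sum_j l1 j) * p + (\sum_j l2 j) * q = 0.
  have /colP/(_ i) := Lx; rewrite !mxE !summxE; apply: etrans.
  rewrite !mulr_suml; congr (_ + _); apply: eq_bigr => j _.
    by rewrite [RHS]mxE S1p.
  by rewrite [RHS]mxE S2q.
move/eqP; rewrite -[X in _ + X * _](addKr (\sum_j l1 j)) L0 addr0 mulNr -mulrBr.
rewrite mulf_eq0 subr_eq0 (negbTE pq) orbF => /eqP l10.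
have l20 : \sum_j l2 j = 0 by move: L0; rewrite l10 add0r.
have [e e0 eL] := exists_scale L.
pose f := \sum_j (e * l1 j) *: zvec R (x1 j).
(* The second family moves by the opposite of [f], so the perturbed parts still add up to [y]. *)
have fE : \sum_j (e * l2 j) *: zvec R (x2 j) = - f.
  apply/eqP; rewrite -addr_eq0 addrC /f.
  under eq_bigr do rewrite -scalerA.
  under [X in _ + X]eq_bigr do rewrite -scalerA.
  by rewrite -!scaler_sumr -scalerDr Lx scaler0.
have pert1 (b : R) : `|b| = 1 -> dilate r%:R S1 (zvec R u + b *: f).
  move=> b1; rewrite uE scaler_sumr.
  under [X in _ + X]eq_bigr do rewrite scalerA.
  apply: dilate_perturb => // [|j].
    by rewrite -mulr_sumr -mulr_sumr l10 !mulr0.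
  by rewrite normrM b1 mul1r; exact: eL.
have pert2 (b : R) : `|b| = 1 ->
    dilate s%:R S2 (zvec R y - (zvec R u + b *: f)).
  move=> b1; rewrite opprD addrA -zvecB -scalerN -fE vE scaler_sumr.
  under [X in _ + X]eq_bigr do rewrite scalerA.
  apply: dilate_perturb => // [|j].
    by rewrite -mulr_sumr -mulr_sumr l20 !mulr0.
  by rewrite normrM b1 mul1r; exact: eL.
have f0 : f = 0.
  apply: uext => /=.
    by rewrite -[f]scale1r; split; [apply: pert1|apply: pert2]; rewrite normr1.
  by rewrite -scaleN1r; split; [apply: pert1|apply: pert2]; rewrite normrN1.
(* Since [f = 0], the joint dependence separates into one dependence for each family. *)
move=> j; have L12 : (forall j, e * l1 j = 0) /\ (forall j, e * l2 j = 0).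
  split; [apply: ind1|apply: ind2] => //; last by rewrite fE f0 oppr0.
    by rewrite -mulr_sumr l10 mulr0.
  by rewrite -mulr_sumr l20 mulr0.
have : e * L j = 0.
  by case: (split_ordP j) => j' ->; [apply: L12.1|apply: L12.2].
by move/eqP; rewrite mulf_eq0 gt_eqF //= => /eqP.
Qed.

Lemma ibox_upd_sub (R : realType) (n : nat) (c d : 'cV[int]_n) (i : 'I_n) :
  c i 0 <= d i 0 ->
  ibox (upd c i (d i 0)) d `|` ibox c (upd d i (c i 0)) `<=`
    (ibox c d : set 'cV[R]_n).
Proof.
move=> cd x; rewrite -(ler_int R) in cd.
case=> bx j; have := bx j; have [->|ji] := eqVneq j i;
  rewrite ?upd_id ?upd_ne // => /andP[? ?]; apply/andP; split=> //.
- exact: le_trans cd _.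
- exact: le_trans cd.
Qed.

(** Degenerate sides are allowed because the induction collapses one side at a time. The inequality
    [c i 0 <= d i 0] comes from a point of the box. *)
Lemma box_decomposition (R : realType) (n k : nat) (P : set 'cV[R]_n)
    (c d y : 'cV[int]_n) :
  classP P -> (forall i, d i 0 <= c i 0 + 1) -> (0 < k)%N ->
  dilate k%:R (P `&` ibox c d) (zvec R y) ->
  decomposition (P `&` ibox c d) k y.
Proof.
move=> PP; have [N] := ubnP #|[pred i | c i 0 != d i 0]|.
elim: N c d k y => // N IH c d k y cdN cd1 k0 Py.
have [z [zk Pz zE]] := integer_decomposition PP k0 Py.
have [/existsP[i cdi]|/existsPn cdE] := boolP [exists i, c i 0 != d i 0];
    last first.
  have zc : {in z, forall v, v = c}.
    move=> v /Pz[_ bv]; apply/colP => i; have := bv i.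
    have /negbNE/eqP <- := cdE i; rewrite -eq_le mxE => /eqP.
    by move/intr_inj => ->.
  have yE : y = c *+ k.
    by rewrite zE (eq_big_seq _ zc) big_const_seq count_predT zk iter_addr_0.
  have cz : c \in z.
    case: z zk zc {Pz zE} => [zk|v z _ zc]; first by rewrite -zk in k0.
    by rewrite -{1}(zc v) ?mem_head.
  exists 1%N, (fun=> c), (fun=> k); split=> //.
  - by move=> l; rewrite big_ord1 => l0 _ j; rewrite ord1.
  - by move=> _; exact: Pz.
  - by rewrite big_ord1.
  by rewrite big_ord1 yE /zvec raddfMn /= scaler_nat.
have di : d i 0 = c i 0 + 1.
  have : c i 0 <= d i 0.
    case: z zk Pz {zE} => [zk|v z _ Pz]; first by rewrite -zk in k0.
    have [_ /(_ i)/andP[cv vd]] := Pz v (mem_head _ _).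
    by rewrite -(ler_int R) (le_trans cv).
  by move: (cd1 i) cdi; move: (c i 0) (d i 0) => a b; lia.
have cd : c i 0 <= d i 0 by rewrite di lerDl.
have := @ibox_upd_sub R n c d i cd.
set c' := upd c i _; set d' := upd d i _ => subU.
(* Both smaller boxes have side [i] degenerate and the other sides unchanged. *)
have ltN (a b : 'cV[int]_n) : a i 0 = b i 0 ->
    (forall j, j != i -> (a j 0 == b j 0) = (c j 0 == d j 0)) ->
    (#|[pred j | (a j 0 != b j 0)%R]| < N)%N.
  move=> abi abj; move: cdN; rewrite ltnS; apply: leq_trans; apply: proper_card.
  apply/properP; split; last by exists i; rewrite !inE ?abi ?eqxx.
  apply/fintype.subsetP => j; rewrite !inE.
  by have [->|/abj ->] := eqVneq j i; rewrite ?abi ?eqxx.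
have ltc : (#|[pred j | (c' j 0 != d j 0)%R]| < N)%N.
  by apply: ltN => [|j ji]; rewrite ?upd_id ?upd_ne.
have ltd : (#|[pred j | (c j 0 != d' j 0)%R]| < N)%N.
  by apply: ltN => [|j ji]; rewrite ?upd_id ?upd_ne.
have c1 j : d j 0 <= c' j 0 + 1.
  by have [->|ji] := eqVneq j i; rewrite ?upd_id ?upd_ne // lerDl.
have d1 j : d' j 0 <= c j 0 + 1.
  by have [->|ji] := eqVneq j i; rewrite ?upd_id ?upd_ne // lerDl.
have [Pky bky] : dilate k%:R P (zvec R y) /\ ibox (c *+ k) (d *+ k) (zvec R y).
  exact/dilate_ibox.
have [r yi rk] : exists2 r : nat, y i 0 = c i 0 *+ k + r%:Z & (r <= k)%N.
  have := bky i; rewrite !mulmxnE di mulrnDl mxE !ler_int.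
  move: (y i 0) (c i 0 *+ k) => a b; exists `|a - b|%N; lia.
(* For [r = 0] or [r = k] the point [y] already lies in the dilate of an end of side [i], and one
   smaller box suffices. *)
have [r0|r_gt0] := posnP r.
  apply: (@decomposition_sub _ _ (P `&` ibox c d')).
    by move=> x [Px bx]; split=> //; apply: subU; right.
  apply: IH => //; apply/dilate_ibox => //; split=> // j.
  have := bky j; rewrite !mulmxnE; have [->|ji] := eqVneq j i.
    by rewrite upd_id mxE yi r0 addr0 lexx.
  by rewrite upd_ne.
have [rk'|r_ne] := eqVneq r k.
  apply: (@decomposition_sub _ _ (P `&` ibox c' d)).
    by move=> x [Px bx]; split=> //; apply: subU; left.
  apply: IH => //; apply/dilate_ibox => //; split=> // j.
  have := bky j; rewrite !mulmxnE; have [->|ji] := eqVneq j i.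
    by rewrite upd_id mxE yi rk' di mulrnDl natz lexx.
  by rewrite upd_ne.
have {r_ne} r_lt : (r < k)%N by rewrite ltn_neqAle r_ne.
have kr : (0 < k - r)%N by rewrite subn_gt0.
have := split_box PP di yi r_gt0 r_lt Py.
case/(split_extreme PP r_gt0 kr) => u uext.
have [[Pu Pyu] _] := uext; rewrite -zvecB in Pyu.
have := IH c' d r u ltc c1 r_gt0 Pu.
have := IH c d' (k - r)%N (y - u) ltd d1 kr Pyu.
move=> dec2 dec1.
rewrite -(subnKC (ltnW r_lt)).
apply: (@decomposition_sub _ _ ((P `&` ibox c' d) `|` (P `&` ibox c d'))).
  by move=> x [] [Px bx]; split=> //; apply: subU; [left|right].
apply: (decomposition_join (i := i) (p := (d i 0)%:~R) (q := (c i 0)%:~R) _ _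
  _ _ _ r_gt0 kr uext dec1 dec2).
- exact: rational_systemPI.
- exact: rational_systemPI.
- by rewrite eqr_int eq_sym.
- by move=> x [_ /(_ i)]; rewrite upd_id -eq_le => /eqP.
- by move=> x [_ /(_ i)]; rewrite upd_id -eq_le => /eqP.
Qed.

(** * Passage to the projection through an extreme point of the fibre *)

Theorem theorem5 (R : realType) (n m : nat) (hmn : (m <= n)%N)
    (P : set 'cV[R]_n) :
  classP P -> ICP (proj hmn @` P).
Proof.
move=> PP; have [/rational_polyhedron_system ratP _] := PP.
split; first exact: polyhedron_proj.
move=> k w k0 /integralP[wz ->] [_ [p0 Pp0 <-]] wE.
pose c := \col_i Num.floor (p0 i 0); pose d := \col_i (c i 0 + 1).
have bp0 : ibox c d p0.
  by move=> i; rewrite !mxE floor_le_tmp ltW // floorD1_gt.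
(* The fibre becomes part of a box: the first [m] sides are degenerate at the coordinates of [k p0],
   where the floor changes nothing since they are those of the integral [w]. The other sides are [k]
   times those of the unit box. *)
pose fl (b : 'cV[int]_n) :=
  \col_(i < n) (if (i < m)%N then Num.floor (k%:R * p0 i 0) else (b *+ k) i 0).
have flE (i : 'I_n) : (i < m)%N ->
    (Num.floor (k%:R * p0 i 0))%:~R = k%:R * p0 i 0.
  move=> im; have -> : i = widen_ord hmn (Ordinal im) by exact: val_inj.
  have /colP/(_ (Ordinal im)) := wE; rewrite !mxE => ->.
  by rewrite intrKfloor.
have [Pkp0 bkp0] : dilate k%:R P (k%:R *: p0) /\
    ibox (c *+ k) (d *+ k) (k%:R *: p0).
  by apply/dilate_ibox => //; exists p0.
have [|u [[Pu bu] uext]] := @dilate_extreme R n k P (fl c) (fl d) PP k0.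
  exists (k%:R *: p0); split=> // i; rewrite ![fl _ i 0]mxE.
  by case: ifP => [/flE ->|_]; [rewrite mxE lexx|exact: bkp0].
have ui (i : 'I_n) : (i < m)%N -> (u i 0)%:~R = k%:R * p0 i 0.
  move=> im; have := bu i; rewrite !mxE im flE // => ?.
  by apply/eqP; rewrite eq_le andbC.
have bku : ibox (c *+ k) (d *+ k) (zvec R u).
  move=> i; have := bu i; have := bkp0 i; rewrite !mxE.
  by case: ifP => // im + _; rewrite ui.
have [||t [x [a [ind Px a0 ak uE]]]] :=
  @box_decomposition R n k P c d u PP _ k0.
- by move=> i; rewrite !mxE.
- exact/dilate_ibox.
exists t, (fun i => proj hmn (zvec R (x i))), a; split=> //.
- move=> l l0 lx.
  have [e e0 el] := exists_scale l.
  pose f := \sum_i (e * l i) *: zvec R (x i).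
  (* A dependence of the projected points gives a combination [f] that vanishes in the first [m]
     coordinates, so perturbing [u] by [f] or its opposite stays in the fibre. *)
  have fi (i : 'I_n) : (i < m)%N -> f i 0 = 0.
    move=> im; have -> : i = widen_ord hmn (Ordinal im) by exact: val_inj.
    have /colP/(_ (Ordinal im)) := lx; rewrite !summxE mxE => lx0.
    rewrite -[RHS](mulr0 e) -[in RHS]lx0 mulr_sumr.
    by apply: eq_bigr => j _; rewrite !mxE mulrA.
  have pert (b : R) : `|b| = 1 ->
      (dilate k%:R P `&` ibox (fl c) (fl d)) (zvec R u + b *: f).
    move=> b1.
    have [Pf bf] : dilate k%:R P (zvec R u + b *: f) /\
        ibox (c *+ k) (d *+ k) (zvec R u + b *: f).
      apply/dilate_ibox => //; rewrite uE scaler_sumr.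
      under [X in _ + X]eq_bigr do rewrite scalerA.
      apply: dilate_perturb => // [||j].
      - exact: rational_systemPI.
      - by rewrite -mulr_sumr -mulr_sumr l0 !mulr0.
      by rewrite normrM b1 mul1r; exact: el.
    split=> // i; have := bf i; have := bu i; rewrite !mxE.
    by case: ifP => // im + _; rewrite fi // mulr0 addr0.
  have f0 : f = 0.
    apply: uext; first by rewrite -[f]scale1r; apply: pert; rewrite normr1.
    by rewrite -scaleN1r; apply: pert; rewrite normrN1.
  (* Extremality of [u] gave [f = 0], so the dependence already holds among the unprojected points,
     which are affinely independent. *)
  move=> i; have : e * l i = 0.
    by apply: (ind (fun i => e * l i)) => //; rewrite -mulr_sumr l0 mulr0.
  by move/eqP; rewrite mulf_eq0 gt_eqF //= => /eqP.
- move=> i; have [Pxi _] := Px i; split; first by exists (zvec R (x i)).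
  by apply/mxOverP => j j'; rewrite !mxE intr_int.
rewrite -wE; apply/colP => j; rewrite summxE !mxE.
rewrite -ui //= -[LHS]/(_ (_ : int)).
have /colP/(_ (widen_ord hmn j)) := uE; rewrite summxE mxE => ->.
by apply: eq_bigr => i _; rewrite !mxE.
Qed.
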